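(* Let $\bm w=(w_j)_{j\ge1}$ be a stationary Markov stick-breaking weights sequence with parameters $(\pi,\psi)$, and let $\bm v=(v_j)_{j\ge1}$ be its underlying Markov chain of length variables. Then: (i) If $\mathbb P\big[\bigcup_{j\ge1}\{v_j=1\}\big]=1$, then $\sum_{j\ge1}w_j=1$ a.s. (ii) If $\pi(\{0\})=0$, then $\sum_{j\ge1}w_j=1$ a.s. (iii) If $\pi$ is $\psi$-ergodic, then $\pi\neq\delta_0$ if and only if $\sum_{j\ge1}w_j=1$ a.s.
   Context: Length variables $\bm v=(v_j)_{j\ge1}$ are $[0,1]$-valued random variables and define stick-breaking weights $w_1=v_1$, $w_j=v_j\prod_{i=1}^{j-1}(1-v_i)$ for $j\ge2$. If $\bm v$ is a time-homogeneous Markov chain with initial distribution $\pi$ (the law of $v_1$) and one-step transition kernel $\psi(v,B)=\mathbb P[v_{j+1}\in B\mid v_j=v]$ on $([0,1],\mathcal B_{[0,1]})$, and $\pi$ is invariant for $\psi$ (i.e. $\pi(B)=\int\psi(v,B)\pi(dv)$ for all Borel $B$, so $\bm v$ is stationary), then $\bm w$ is called a stationary Markov stick-breaking weights sequence with parameters $(\pi,\psi)$. The set of $\psi$-invariant probability measures is convex; $\pi$ is called $\psi$-ergodic if it is an extreme point of this set. *)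

(* Defs.v *)
From HB Require Import structures.
From mathcomp Require Import all_boot all_order all_algebra.
From mathcomp Require Import all_classical all_reals all_analysis.
Set Implicit Arguments. Unset Strict Implicit. Unset Printing Implicit Defensive.
Import Order.TTheory GRing.Theory Num.Theory numFieldNormedType.Exports.
Local Open Scope classical_set_scope.
Local Open Scope ring_scope.

(* State space: [0,1] is encoded as the Borel subset `[0,1] of R.
   Length variables are indexed from 0: (v j) is the paper's v_{j+1}. *)

(* g_{B_0,...,B_n}(x) = 1_{B_0}(x) * \int psi(x,dy) g_{B_1,...,B_n}(y),
   with g_{[::]} = 1.  Then P[v_0 \in B_0, ..., v_n \in B_n]
   = \int pi(dx) g_{B_0,...,B_n}(x). *)
Fixpoint mc_fdd (R : realType) (psi : R.-pker R ~> R) (Bs : seq (set R))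
  : R -> \bar R :=
  match Bs with
  | [::] => fun _ => 1%E
  | B :: Bs' => fun x => ((\1_B x)%:E * \int[psi x]_y mc_fdd psi Bs' y)%E
  end.

Definition is_markov_chain (R : realType) (d : measure_display)
  (Omega : measurableType d) (P : probability Omega R)
  (v : nat -> Omega -> R) (pi : probability R R) (psi : R.-pker R ~> R) :=
  (forall j, measurable_fun setT (v j)) /\
  forall Bs : seq (set R), (forall B, B \in Bs -> measurable B) ->
    P (\bigcap_(j in [set j | (j < size Bs)%N])
         (v j @^-1` nth set0 Bs j)) =
    (\int[pi]_x mc_fdd psi Bs x)%E.

Definition psi_invariant (R : realType) (psi : R.-pker R ~> R)
  (mu : probability R R) :=
  mu `[0, 1]%classic = 1%E /\
  forall B : set R, measurable B -> mu B = (\int[mu]_x psi x B)%E.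

Definition kernel_on_unit (R : realType) (psi : R.-pker R ~> R) :=
  forall x : R, 0 <= x <= 1 -> psi x `[0, 1]%classic = 1%E.

(* pi is an extreme point of the convex set of psi-invariant probability
   measures (on [0,1]). *)
Definition ergodic (R : realType) (psi : R.-pker R ~> R)
  (pi : probability R R) :=
  psi_invariant psi pi /\
  forall (mu1 mu2 : probability R R) (t : R),
    psi_invariant psi mu1 -> psi_invariant psi mu2 -> 0 < t < 1 ->
    (forall B, measurable B -> pi B = (t%:E * mu1 B + (1 - t)%:E * mu2 B)%E) ->
    forall B, measurable B -> mu1 B = mu2 B.

Definition sb_weights (R : realType) (T : Type) (v : nat -> T -> R)
  (j : nat) (t : T) : R :=
  v j t * \prod_(i < j) (1 - v i t).

Definition sums_to_one_as (R : realType) (d : measure_display)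
  (Omega : measurableType d) (P : probability Omega R) (v : nat -> Omega -> R) :=
  {ae P, forall t, (fun n => \sum_(j < n) sb_weights v j t) @ \oo --> (1 : R)}.

(* Main.v *)
Require Import Defs.
From HB Require Import structures.
From mathcomp Require Import all_boot all_order all_algebra.
From mathcomp Require Import all_classical all_reals all_analysis.
From mathcomp Require Import measurable_realfun ring.
Set Implicit Arguments.
Unset Strict Implicit.
Unset Printing Implicit Defensive.

Import Order.TTheory GRing.Theory Num.Theory numFieldNormedType.Exports.
Local Open Scope classical_set_scope.
Local Open Scope ring_scope.

(** The partial sums of the weights are 1 - \prod_(i < n) (1 - v_i), so if they
    do not converge to 1 then the product has a positive limit, so v_j -> 0.
    By stationarity, P(v_j -> 0) <= P(v_0 = ... = v_(n-1) = 0) for every n: on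
    v_j -> 0 the blocks of length n are eventually in [-e, e], and the law of a
    block does not depend on its position; then let e -> 0.  For q = psi(0, {0}),
    the right-hand side is pi {0} * q ^ (n - 1).  It vanishes when pi {0} = 0,
    and tends to 0 when q < 1.  When q = 1, the Dirac mass at 0 is invariant, so
    for 0 < pi {0} < 1 the measure pi is a nontrivial mixture of it and of
    pi conditioned on the complement of 0, which is then invariant too,
    against ergodicity. *)

(* psi as a kernel ignoring its first argument, the form required by
   integral_kcomp. *)
Definition psi_snd (R : realType) (psi : R.-pker R ~> R) :
  (R * R)%type -> {measure set R -> \bar R} := psi \o snd.

Section psi_snd.
Context (R : realType) (psi : R.-pker R ~> R).

Let measurable_psi_snd U : measurable U ->
  measurable_fun [set: R * R] (psi_snd psi ^~ U).
Proof.
move=> mU; rewrite [X in measurable_fun _ X](_ : _ = psi ^~ U \o snd)//.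
exact: measurableT_comp (measurable_kernel psi U mU) measurable_snd.
Qed.

HB.instance Definition _ := isKernel.Build _ _ _ _ R (psi_snd psi)
  measurable_psi_snd.

Let psi_snd_setT x : psi_snd psi x setT = 1%E.
Proof. exact: prob_kernel. Qed.

HB.instance Definition _ := Kernel_isProbability.Build _ _ _ _ R (psi_snd psi)
  psi_snd_setT.

End psi_snd.

(** * Integration against an invariant measure *)

Lemma integral_invariant (R : realType) (psi : R.-pker R ~> R)
    (mu : probability R R) (f : R -> \bar R) :
  psi_invariant psi mu -> (forall x, 0 <= f x)%E -> measurable_fun setT f ->
  (\int[mu]_x f x = \int[mu]_x \int[psi x]_y f y)%E.
Proof.
move=> [_ muE] f0 mf.
(* The constant kernel at [mu] makes the double integral one against a kernel composition, which
   equals [mu] by invariance. *)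
pose l := kprobability (@measurable_cst _ _ R (pprobability R R) setT mu).
have := @integral_kcomp _ _ _ _ _ _ _ l (psi_snd psi) 0 f f0 mf.
move=> /= <-; apply: eq_measure_integral => A mA _.
exact: muE.
Qed.

(** * Iterated integrals giving the laws of the chain *)

Section mc_fdd.
Context (R : realType) (psi : R.-pker R ~> R).

Lemma mc_fdd_ge0 Bs x : (0 <= mc_fdd psi Bs x)%E.
Proof.
elim: Bs x => [//|B Bs IH] x /=; rewrite mule_ge0 ?lee_fin//.
exact: integral_ge0.
Qed.

Lemma measurable_mc_fdd Bs : (forall B, B \in Bs -> measurable B) ->
  measurable_fun setT (mc_fdd psi Bs).
Proof.
elim: Bs => [|B Bs IH] mBs /=; first exact: measurable_cst.
apply: emeasurable_funM.
  by apply/measurable_EFinP/measurable_indic; apply: mBs; rewrite mem_head.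
apply: measurable_fun_integral_kernel.
- by move=> U; exact: measurable_kernel.
- exact: mc_fdd_ge0.
- by apply: IH => A ABs; apply: mBs; rewrite in_cons ABs orbT.
Qed.

(** This is stationarity: each leading [setT] amounts to one averaging by [psi], which invariance
    absorbs. *)
Lemma integral_mc_fdd_shift (mu : probability R R) N Bs :
  psi_invariant psi mu -> (forall B, B \in Bs -> measurable B) ->
  (\int[mu]_x mc_fdd psi (nseq N setT ++ Bs) x = \int[mu]_x mc_fdd psi Bs x)%E.
Proof.
move=> muinv mBs; elim: N => [//|N IH].
rewrite -IH [RHS](@integral_invariant _ psi)//=.
- by apply: eq_integral => x _; rewrite indicT mul1e.
- exact: mc_fdd_ge0.
- apply: measurable_mc_fdd => B; rewrite mem_cat => /orP[|/mBs//].
  by rewrite mem_nseq => /andP[_ /eqP ->].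
Qed.

(** The exponent is [n] because [n.+1] visits involve [n] transitions: the innermost integral, of
    the constant 1, has value 1. *)
Lemma mc_fdd_nseq1 (a q x : R) n : psi a [set a] = q%:E ->
  mc_fdd psi (nseq n.+1 [set a]) x = (\1_[set a] x * q ^+ n)%:E.
Proof.
move=> psiq; elim: n x => [|n IH] x.
  by rewrite /= integral_cst// mul1e [psi x _]prob_kernel mule1 mulr1.
transitivity ((\1_[set a] x)%:E * \int[psi x]_y (\1_[set a] y * q ^+ n)%:E)%E.
  by congr (_ * _)%E; apply: eq_integral => y _; exact: IH.
have [->|xa] := eqVneq x a; last first.
  by rewrite indicE memNset ?mul0e ?mul0r// => /eqP; rewrite (negbTE xa).
have q0 : 0 <= q by rewrite -lee_fin -psiq.
under eq_integral do rewrite mulrC EFinM.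
rewrite ge0_integralZl//; last 2 first.
- exact/measurable_EFinP/measurable_indic.
- by rewrite lee_fin exprn_ge0.
by rewrite integral_indic//= setIT psiq -!EFinM -exprSr.
Qed.

Lemma integral_mc_fdd_nseq1 (mu : probability R R) (a q : R) n :
  psi a [set a] = q%:E ->
  (\int[mu]_x mc_fdd psi (nseq n.+1 [set a]) x =
   mu [set a] * (q ^+ n)%:E)%E.
Proof.
move=> psiq; have q0 : 0 <= q by rewrite -lee_fin -psiq.
under eq_integral do rewrite (mc_fdd_nseq1 _ _ psiq) mulrC EFinM.
rewrite ge0_integralZl//; last 2 first.
- exact/measurable_EFinP/measurable_indic.
- by rewrite lee_fin exprn_ge0.
by rewrite integral_indic//= setIT muleC.
Qed.

End mc_fdd.

(** * Dirac masses, mixtures and extremality *)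

Lemma set1_mass1_dirac (R : realType) (mu : {measure set R -> \bar R})
    (a : R) B :
  mu setT = 1%E -> mu [set a] = 1%E -> measurable B -> mu B = \d_a B.
Proof.
move=> muT mua mB; have ma := measurable_set1 a.
have mu0 : mu (~` [set a]) = 0%E.
  have : (1 = mu (~` [set a]) + 1)%E.
    rewrite -[LHS]muT -[X in (_ + X)%E]mua -setTD -[X in (_ + mu X)%E]setTI.
    exact: measureDI.
  by move=> /(congr1 (fun z => z - 1)%E); rewrite subee// addeK.
transitivity (mu (B `\` [set a]) + mu (B `&` [set a]))%E.
  exact: measureDI.
rewrite setI1 diracE.
have -> : mu (B `\` [set a]) = 0%E.
  apply: subset_measure0 mu0; [exact: measurableD|exact: measurableC|].
  by move=> x [].
by case: ifPn => _; rewrite add0e// measure0.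
Qed.

Section mixture.
Context (R : realType) (psi : R.-pker R ~> R).
Variables (pi mu1 mu2 : probability R R) (t : R).
Hypotheses (t01 : 0 < t < 1)
  (piE : forall B, measurable B ->
     pi B = (t%:E * mu1 B + (1 - t)%:E * mu2 B)%E).

Lemma integral_mixture (f : R -> \bar R) :
  (forall x, 0 <= f x)%E -> measurable_fun setT f ->
  (\int[pi]_x f x = t%:E * \int[mu1]_x f x + (1 - t)%:E * \int[mu2]_x f x)%E.
Proof.
move: t01 => /andP[t0 t1] f0 mf.
have s0 : 0 <= 1 - t by rewrite subr_ge0 ltW.
pose m1 := mscale (NngNum (ltW t0)) mu1; pose m2 := mscale (NngNum s0) mu2.
rewrite (@eq_measure_integral _ _ _ _ (measure_add m1 m2)); last first.
  move=> A mA _; transitivity (m1 A + m2 A)%E; first exact: piE.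
  exact/esym/measure_addE.
by rewrite ge0_integral_measure_add// !ge0_integral_mscale.
Qed.

(** The invariance equation is affine in the measure, so subtracting [t] times that of [mu1] from
    that of [pi] leaves that of [mu2]. *)
Lemma psi_invariant_mixture :
  psi_invariant psi pi -> psi_invariant psi mu1 -> psi_invariant psi mu2.
Proof.
move=> [pi1 piI] [mu11 mu1I]; have /andP[t0 t1] := t01.
(* Cancellation is legitimate in the extended reals since [t%:E * a] is finite and [1 - t] is
   nonzero. *)
have cancel x y a : (a \is a fin_num)%E ->
    (t%:E * a + (1 - t)%:E * x = t%:E * a + (1 - t)%:E * y -> x = y)%E.
  move=> afin; have ta : (t%:E * a)%E \is a fin_num by rewrite fin_numM.
  move=> /(congr1 (fun z => z - t%:E * a)%E).
  rewrite !(addeC (t%:E * a)%E) !addeK//.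
  move=> /(congr1 (fun z => ((1 - t)^-1)%:E * z)%E).
  rewrite !muleA -EFinM mulVf ?mul1e//.
  by rewrite gt_eqF// subr_gt0.
split=> [|B mB].
  apply: (cancel _ _ 1%E) => //; rewrite -{1}mu11 -piE//.
  by rewrite pi1 !mule1 -EFinD addrC subrK.
apply: (cancel _ _ (mu1 B)); first exact: fin_num_measure.
rewrite -piE// piI// integral_mixture//; last exact: measurable_kernel.
by rewrite -mu1I.
Qed.

End mixture.

Lemma ergodic_absorbing_atom (R : realType) (psi : R.-pker R ~> R)
    (pi : probability R R) (a : R) :
  psi a [set a] = 1%E -> 0 <= a <= 1 -> ergodic psi pi ->
  pi [set a] = 0%E \/ pi [set a] = 1%E.
Proof.
move=> psia a01 [piinv piext].
have fp : pi [set a] \is a fin_num by exact: fin_num_measure.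
have [->|p0] := eqVneq (pi [set a]) 0%E; first by left.
have [->|p1] := eqVneq (pi [set a]) 1%E; first by right.
exfalso.
pose t := fine (pi [set a]).
have tE : pi [set a] = t%:E by rewrite fineK.
have t0 : 0 < t.
  by rewrite -lte_fin -tE lt0e p0 measure_ge0.
have t1 : t < 1.
  by rewrite -lte_fin -tE lt_neqAle p1/= probability_le1.
have t01 : 0 < t < 1 by rewrite t0 t1.
pose nu : {measure set R -> \bar R} :=
  mrestr pi (measurableC (measurable_set1 a)).
have nuE B : nu B = pi (B `&` ~` [set a]) by [].
have nuT : nu setT = (1 - t)%:E.
  by rewrite nuE setTI probability_setC// tE.
pose mu1 : probability R R := \d_a.
(* The second argument of [mnormalize] is a default for a mass 0 or infinite; here the mass of [nu]
   is [1 - t > 0]. *)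
pose mu2 : probability R R := mnormalize nu pi.
have mu2E B : mu2 B = (nu B * ((1 - t)^-1)%:E)%E.
  transitivity (mnormalize nu pi B) => //; rewrite /mnormalize.
  have -> : nu setT = (1 - t)%:E by exact: nuT.
  by rewrite eqe subr_eq0 (gt_eqF t1).
have piE B : measurable B -> pi B = (t%:E * mu1 B + (1 - t)%:E * mu2 B)%E.
  move=> mB; have -> : ((1 - t)%:E * mu2 B = pi (B `&` ~` [set a]))%E.
    by rewrite mu2E muleCA -EFinM mulfV ?mule1// gt_eqF// subr_gt0.
  rewrite (measureDI pi mB (measurable_set1 a)) setDE addeC; congr (_ + _)%E.
  by rewrite /mu1/= diracE setI1; case: ifPn => _;
    rewrite ?mule1 ?mule0 ?measure0.
have mu1inv : psi_invariant psi mu1.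
  split=> [|B mB]; first by rewrite /mu1/= diracE mem_set//= in_itv.
  rewrite /mu1/= integral_dirac//; last exact: measurable_kernel.
  by rewrite diracT mul1e (@set1_mass1_dirac _ (psi a) a)// [LHS]prob_kernel.
have mu2inv := psi_invariant_mixture t01 piE piinv mu1inv.
(* Extremality fails on [[set a]] itself, which has mass 1 under [mu1] and 0 under [mu2]. *)
have := piext _ _ _ mu1inv mu2inv t01 piE _ (measurable_set1 a).
rewrite mu2E nuE setICr measure0 mul0e /mu1/= diracE mem_set//=.
by move/eqP; rewrite onee_eq0.
Qed.

(** * Stationary blocks and the event of convergence to 0 *)

Section chain.
Context (R : realType) (d : measure_display) (Omega : measurableType d)
  (P : probability Omega R) (v : nat -> Omega -> R)
  (pi : probability R R) (psi : R.-pker R ~> R).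
Hypotheses (hinv : psi_invariant psi pi) (hmc : is_markov_chain P v pi psi).

Lemma measurable_chain_preimage j (B : set R) : measurable B ->
  measurable (v j @^-1` B).
Proof. by move=> mB; rewrite -[X in measurable X]setTI; exact: hmc.1. Qed.

(** Padding with [N] copies of [setT] turns a block starting at [N] into a finite-dimensional event
    from time 0; the shift lemma then removes the padding. *)
Lemma prob_block N n (B : set R) : measurable B ->
  P (\bigcap_(j in `I_n) (v (N + j)%N @^-1` B)) =
  (\int[pi]_x mc_fdd psi (nseq n B) x)%E.
Proof.
move=> mB; have [_ fdd] := hmc.
rewrite -(integral_mc_fdd_shift N hinv); last first.
  by move=> A; rewrite mem_nseq => /andP[_ /eqP ->].
rewrite -fdd; last first.
  move=> A; rewrite mem_cat !mem_nseq.
  by move=> /orP[] /andP[_ /eqP ->].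
congr (P _); rewrite size_cat !size_nseq.
apply/seteqP; split => t /= Ht j /= jn.
  rewrite nth_cat size_nseq; case: ltnP => jN; first by rewrite nth_nseq jN.
  have jn' : (j - N < n)%N by rewrite ltn_subLR.
  by rewrite nth_nseq jn'; have := Ht _ jn'; rewrite /= subnKC.
have := Ht (N + j)%N; rewrite /= ltn_add2l nth_cat size_nseq => /(_ jn).
by rewrite ltnNge leq_addr/= addKn nth_nseq jn.
Qed.

Lemma measurable_block N n (B : set R) : measurable B ->
  measurable (\bigcap_(j in `I_n) (v (N + j)%N @^-1` B)).
Proof.
move=> mB; apply: bigcap_measurableType => // j _.
exact: measurable_chain_preimage.
Qed.

(** The events [D N] increase, so the probability of their union is a limit, and each [D N] lies in
    a block event of length [n] whose probability is free of [N]. *)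
Lemma prob_eventually_le n (B : set R) : measurable B ->
  (P (\bigcup_N \bigcap_j (v (N + j)%N @^-1` B)) <=
   \int[pi]_x mc_fdd psi (nseq n B) x)%E.
Proof.
move=> mB; pose D N := \bigcap_j (v (N + j)%N @^-1` B).
have mD N : measurable (D N).
  apply: bigcap_measurableType => // j _.
  exact: measurable_chain_preimage.
have ndD : nondecreasing_seq D.
  apply/nondecreasing_seqP => N; apply/subsetPset => t Dt j _ /=.
  by rewrite addSnnS; exact: Dt.
have cvD := nondecreasing_cvg_mu (mu := P) mD (bigcupT_measurable D mD) ndD.
rewrite -/(D) -(cvg_lim _ cvD)//; apply: lime_le; first exact: cvgP cvD.
near=> N; rewrite -(prob_block N n mB) le_measure ?inE//.
  exact: measurable_block.
by move=> t Dt j _; exact: Dt.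
Unshelve. all: by end_near. Qed.

Let I k : set R := `[- k.+1%:R^-1, k.+1%:R^-1].

Let bigcap_I : \bigcap_k I k = [set 0].
Proof.
apply/seteqP; split => [x Ix|_ -> k _]; last first.
  by rewrite /I /= in_itv/= oppr_le0 invr_ge0 ler0n.
apply/eqP; rewrite -normr_le0; apply/ler_addgt0Pl => e e0; rewrite addr0.
have [k _ ke] := near_infty_natSinv_lt (PosNum e0).
have := Ix k Logic.I; rewrite /I /= in_itv/= -ler_norml => /le_trans; apply.
by apply/ltW/(ke k) => /=.
Qed.

Let nincr_I : nonincreasing_seq I.
Proof.
apply/nonincreasing_seqP => k; apply/subsetPset => x.
rewrite /I /= !in_itv/= -!ler_norml => /le_trans; apply.
by rewrite lef_pV2 ?posrE// ler_nat.
Qed.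

(** The measurable cover [W] is chosen before [n], so that all the bounds apply to the same
    event. *)
Lemma prob_cvg0_le :
  exists2 W, measurable W /\ [set t | v ^~ t @ \oo --> (0 : R)] `<=` W &
    forall n, (P W <= \int[pi]_x mc_fdd psi (nseq n [set 0%R]) x)%E.
Proof.
pose U k := \bigcup_N \bigcap_j (v (N + j)%N @^-1` I k).
have mU k : measurable (U k).
  apply: bigcupT_measurable => N; apply: bigcap_measurableType => // j _.
  by apply: measurable_chain_preimage; exact: measurable_itv.
have mW : measurable (\bigcap_k U k) by apply: bigcap_measurableType.
exists (\bigcap_k U k).
  split=> // t vt k _.
  have k0 : 0 < k.+1%:R^-1 :> R by rewrite invr_gt0.
  have /cvgr0Pnorm_le/(_ _ k0)[N _ HN] := vt.
  exists N => // j _; rewrite /I /= in_itv/= -ler_norml.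
  by apply: HN => /=; exact: leq_addr.
move=> n; pose C k := \bigcap_(j in `I_n) (v (0 + j)%N @^-1` I k).
have mC k : measurable (C k) by apply: measurable_block; exact: measurable_itv.
have CE : \bigcap_k C k = \bigcap_(j in `I_n) (v (0 + j)%N @^-1` [set 0]).
  rewrite -bigcap_I; apply/seteqP; split => t Ct i Hi j Hj.
  - exact: Ct.
  - exact: Ct.
have niC : nonincreasing_seq C.
  move=> k l kl; apply/subsetPset => t Ct j jn.
  by have /subsetPset := nincr_I kl; apply; exact: Ct.
have C0 : (P (C 0%N) < +oo)%E by rewrite ltey_eq fin_num_measure.
(* Continuity from above: the [C k] decrease to the event that the first [n] variables vanish. *)
have cvC : P \o C @ \oo --> (\int[pi]_x mc_fdd psi (nseq n [set 0%R]) x)%E.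
  rewrite -(prob_block 0 n (measurable_set1 0)) -CE.
  by apply: nonincreasing_cvg_mu => //; exact: bigcapT_measurable.
rewrite -(cvg_lim _ cvC)//; apply: lime_ge; first exact: cvgP cvC.
(* [W] lies in every [U k], and [P (U k)] is at most the block probability [P (C k)]. *)
near=> k; apply: (@le_trans _ _ (P (U k))).
  by rewrite le_measure ?inE// => t; exact.
by rewrite /= /C prob_block; [apply: prob_eventually_le|];
  exact: measurable_itv.
Unshelve. all: by end_near. Qed.

End chain.

(** * Stick-breaking along a single trajectory *)

Section stick_breaking.
Context (R : realType) (T : Type) (v : nat -> T -> R) (t : T).

Lemma sum_sb_weights n :
  \sum_(j < n) sb_weights v j t = 1 - \prod_(i < n) (1 - v i t).
Proof.
elim: n => [|n IH]; first by rewrite !big_ord0 subrr.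
by rewrite !big_ord_recr/= IH /sb_weights; ring.
Qed.

Hypothesis v01 : forall j, 0 <= v j t <= 1.

(** The products [A n] decrease to a limit: limit 0 gives sum 1, while a positive limit forces the
    ratios [A n.+1 / A n] to tend to 1. *)
Lemma sb_weights_sum1_or_cvg0 :
  (fun n => \sum_(j < n) sb_weights v j t) @ \oo --> (1 : R) \/
  v ^~ t @ \oo --> (0 : R).
Proof.
pose A n : R := \prod_(i < n) (1 - v i t).
have A0 n : 0 <= A n.
  by apply: prodr_ge0 => i _; rewrite subr_ge0; case/andP: (v01 i).
have AS n : A n.+1 = A n * (1 - v n t) by rewrite /A big_ord_recr.
have niA : nonincreasing_seq A.
  apply/nonincreasing_seqP => n; rewrite AS ler_piMr//.
  by rewrite gerBl; case/andP: (v01 n).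
have cvA : cvgn A by apply: nonincreasing_is_cvgn => //; exists 0 => _ [n _ <-].
have [l0|l0] := eqVneq (limn A) 0.
  left; under eq_fun do rewrite sum_sb_weights.
  have : (fun n => 1 - A n) @ \oo --> (1 - 0 : R).
    by apply: cvgB; [exact: cvg_cst|rewrite -l0].
  by rewrite subr0.
right.
have lgt0 : 0 < limn A.
  by rewrite lt_neqAle eq_sym l0/= limr_ge//; exact: nearW.
have Agt0 n : 0 < A n.
  exact: lt_le_trans lgt0 (nonincreasing_cvgn_ge niA cvA n).
rewrite (_ : v ^~ t = (fun n => 1 - A n.+1 * (A n)^-1)); last first.
  by apply/funext => n; rewrite AS mulrAC divff ?gt_eqF// mul1r subKr.
have : (fun n => 1 - A n.+1 * (A n)^-1) @ \oo --> 1 - limn A * (limn A)^-1.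
  apply: cvgB; first exact: cvg_cst.
  apply: cvgM; last exact: cvgV.
  by have := cvA; rewrite -(cvg_shiftS A).
by rewrite divff// subrr.
Qed.

Lemma sb_weights_sum1_of_one j : v j t = 1 ->
  (fun n => \sum_(j < n) sb_weights v j t) @ \oo --> (1 : R).
Proof.
(* From [n = j.+1] on, the product contains the factor [1 - v j t = 0], so the partial sum is
   exactly 1. *)
move=> vj; apply: cvg_near_cst; exists j.+1 => // n /= jn.
by rewrite sum_sb_weights (bigD1 (Ordinal jn))//= vj subrr mul0r subr0.
Qed.
End stick_breaking.

(** * Almost sure summation to one *)

Section chain_sums.
Context (R : realType) (d : measure_display) (Omega : measurableType d)
  (P : probability Omega R) (v : nat -> Omega -> R)
  (pi : probability R R) (psi : R.-pker R ~> R).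
Hypotheses (v01 : forall j t, 0 <= v j t <= 1)
  (hinv : psi_invariant psi pi) (hmc : is_markov_chain P v pi psi).

Lemma sums_to_one_of_fdd0 :
  (forall e, 0 < e ->
     exists n, (\int[pi]_x mc_fdd psi (nseq n [set 0%R]) x <= e%:E)%E) ->
  sums_to_one_as P v.
Proof.
move=> small; have [W [mW vW] PW] := prob_cvg0_le hinv hmc.
exists W; split=> //.
  apply/eqP; rewrite -measure_le0; apply/lee_addgt0Pr => e e0; rewrite add0e.
  by have [n ne] := small e e0; exact: le_trans (PW n) ne.
move=> t nt; apply: vW.
by have [//|] := sb_weights_sum1_or_cvg0 (v01 ^~ t).
Qed.

Lemma sums_to_one_of_exists_one :
  P (\bigcup_j [set t | v j t = 1]) = 1%E -> sums_to_one_as P v.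
Proof.
set M := \bigcup_j _ => PM.
have mM : measurable M.
  apply: bigcupT_measurable => j.
  exact: (measurable_chain_preimage hmc j (measurable_set1 1)).
exists (~` M); split; first exact: measurableC.
  by rewrite probability_setC// PM subee.
by move=> t /= nt [j _ vj]; apply: nt; exact: sb_weights_sum1_of_one vj.
Qed.

(** By stationarity every [v n] is 0 almost surely, so almost surely all weights vanish and the
    partial sums stay at 0. *)
Lemma not_sums_to_one_dirac0 : pi [set 0] = 1%E -> ~ sums_to_one_as P v.
Proof.
move=> pi0 sum1.
(* The value of [q] drops out below, since a block of length 1 carries exponent 0. *)
have [q psiq] : exists q, psi 0 [set 0] = q%:E.
  exists (fine (psi 0 [set 0])); rewrite fineK// ge0_fin_numE//.
  apply: (@le_lt_trans _ _ (psi 0 setT)); first by rewrite le_measure ?inE.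
  by rewrite [psi 0 _]prob_kernel ltry.
have v0 n : P.-negligible [set t | v n t != 0].
  have m0 : measurable (v n @^-1` [set 0]).
    exact: (measurable_chain_preimage hmc).
  exists (~` (v n @^-1` [set 0])); split; first exact: measurableC.
    rewrite probability_setC//.
    have := prob_block hinv hmc n 1 (measurable_set1 0).
    rewrite (integral_mc_fdd_nseq1 pi 0 psiq) mule1 pi0.
    rewrite (_ : \bigcap_(_ in _) _ = v n @^-1` [set 0]) => [->|].
      by rewrite subee.
    apply/seteqP; split=> t /=; first by move=> /(_ 0%N erefl); rewrite addn0.
    by move=> vt [|//] _; rewrite /= addn0.
  by move=> t /= /eqP.
(* The whole space is covered by the null set where the sum is not 1 and those where some [v n] is
   nonzero. *)
have : P setT = 0%E.
  apply/negligibleP => //.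
  apply: negligibleS (negligibleU sum1 (negligible_bigcup v0)) => t _.
  have [[n vn]|/forallNP vt] := pselect (exists n, v n t != 0).
    by right; exists n.
  left=> /= cv1.
  have : (fun n => \sum_(j < n) sb_weights v j t) @ \oo --> (0 : R).
    rewrite (_ : (fun _ => _) = cst 0); first exact: cvg_cst.
    apply/funext => n; rewrite big1// => j _; rewrite /sb_weights.
    by have /negP/negPn/eqP -> := vt j; rewrite mul0r.
  move=> /(cvg_unique _ cv1) /eqP; rewrite oner_eq0.
  by move=> /(_ (@norm_hausdorff _ _)).
by rewrite probability_setT => /eqP; rewrite onee_eq0.
Qed.

End chain_sums.

Theorem mainTheorem1 (R : realType) (d : measure_display)
  (Omega : measurableType d) (P : probability Omega R)
  (v : nat -> Omega -> R) (pi : probability R R) (psi : R.-pker R ~> R)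
  (hv01 : forall j t, 0 <= v j t <= 1)
  (hpi01 : pi `[0, 1]%classic = 1%E)
  (hpsi01 : kernel_on_unit psi)
  (hinv : psi_invariant psi pi)
  (hmc : is_markov_chain P v pi psi) :
  (P (\bigcup_j [set t | v j t = 1]) = 1%E -> sums_to_one_as P v) /\
  (pi [set 0] = 0%E -> sums_to_one_as P v) /\
  (ergodic psi pi ->
     ((exists B, measurable B /\ pi B <> \d_(0 : R) B) <-> sums_to_one_as P v)).
Proof.
have psi0_le1 : (psi 0%R [set 0%R] <= 1)%E.
  by rewrite -(prob_kernel (s := psi) 0) le_measure ?inE.
have psi0_fin : psi 0 [set 0] \is a fin_num.
  by rewrite ge0_fin_numE//; exact: le_lt_trans psi0_le1 (ltry _).
pose q := fine (psi 0 [set 0]).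
have psiq : psi 0 [set 0] = q%:E by rewrite fineK.
have fdd0 n := integral_mc_fdd_nseq1 pi n psiq.
have null_atom : pi [set 0] = 0%E -> sums_to_one_as P v.
  move=> pi0; apply: (sums_to_one_of_fdd0 hv01 hinv hmc) => e e0.
  by exists 1%N; rewrite fdd0 pi0 mul0e lee_fin ltW.
split; first exact: (sums_to_one_of_exists_one hmc).
split=> // erg; split=> [[B [mB piB]]|sum1]; last first.
  have pi0 : pi [set 0] <> 1%E.
    by move=> pi0; exact: (not_sums_to_one_dirac0 hinv hmc pi0 sum1).
  (* The set [[set 0]] separates the measures: its Dirac mass is 1. *)
  exists [set 0]; split; first exact: measurable_set1.
  by rewrite diracE mem_set.
have pi0 : pi [set 0] <> 1%E.
  move=> pi0; apply: piB.
  by apply: (set1_mass1_dirac _ pi0 mB); exact: probability_setT.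
(* If [q = 1], then 0 is absorbing and ergodicity leaves mass 0 or 1 at 0, the latter being
   excluded; otherwise the block probabilities decay geometrically. *)
have [q1|q1] := eqVneq q 1.
  rewrite q1 in psiq; apply: null_atom.
  by have [] := ergodic_absorbing_atom psiq _ erg; first by rewrite lexx ler01.
apply: (sums_to_one_of_fdd0 hv01 hinv hmc) => e e0.
have q0 : 0 <= q by rewrite fine_ge0.
have q_lt1 : `|q| < 1.
  by rewrite ger0_norm// lt_neqAle q1/= -lee_fin -psiq.
have /cvgr0Pnorm_lt/(_ _ e0)[n _ qn] := cvg_expr q_lt1.
exists n.+1; rewrite fdd0; apply: (@le_trans _ _ (1 * (q ^+ n)%:E)%E).
  by rewrite lee_pmul// ?lee_fin ?exprn_ge0// probability_le1.
rewrite mul1e lee_fin ltW//; apply: le_lt_trans (ler_norm _) _.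
by apply: qn => /=.
Qed.
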